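(* Let $q\in\mathbb{C}$ be such that $[n]_q\neq 0$ for all $n\geq 1$, let $u\in\mathbb{C}\setminus\{0\}$, $\alpha,a\in\mathbb{C}$, let $(a_n^{(\alpha)})_{n\ge0}$ be complex numbers with $a_0^{(\alpha)}\neq0$, $(\mathcal{A}_q(t))^{\alpha}=\sum_{n\ge0}a_n^{(\alpha)}\frac{t^n}{[n]_q!}$, and define $\mathrm{P}_{n,q}^{(\alpha)}(x,y;u)$ by $(\mathcal{A}_q(t))^{\alpha}\mathrm{e}_q(tx)\mathrm{e}_q(ty,u)=\sum_{n\ge0}\mathrm{P}_{n,q}^{(\alpha)}(x,y;u)\frac{t^n}{[n]_q!}$. Let $(\mathrm{A}_{n,q}(a;u))_{n\ge0}$ be the sequence determined by the recursion $$\sum_{k=0}^{n}\genfrac{[}{]}{0pt}{}{n}{k}_{q}u^{k(k-n)}a^k\mathrm{A}_{n-k,q}(a;u)=1\qquad(n\ge0).$$ Then for all $n\ge0$, $$\mathrm{P}_{n,q}^{(\alpha)}(x,y;u)=\sum_{k=0}^{n}\genfrac{[}{]}{0pt}{}{n}{k}_{q}u^{\binom{k}{2}}\mathrm{A}_{k,q}(a;u)y^k\mathrm{P}_{n-k,q}^{(\alpha)}(x,ay;u).$$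
   Context: $[n]_q=\frac{1-q^n}{1-q}$, $[n]_q!=[1]_q\cdots[n]_q$ ($[0]_q!=1$), $\genfrac{[}{]}{0pt}{}{n}{k}_{q}=\frac{[n]_q!}{[k]_q![n-k]_q!}$. $\mathrm{e}_q(z,u)=\sum_{n\ge0}u^{\binom{n}{2}}\frac{z^n}{[n]_q!}$, $\mathrm{e}_q(z)=\mathrm{e}_q(z,1)$. Identities are of formal power series in $t$. *)

(* Defs.v *)
From mathcomp Require Export all_boot all_order all_algebra.
From mathcomp Require Export complex reals.

Set Implicit Arguments.
Unset Strict Implicit.
Unset Printing Implicit Defensive.

Import GRing.Theory.
Local Open Scope ring_scope.

(* Since 0^-1 = 0 in MathComp, the quotient alone would give [n]_1 = 0; at
   q = 1 we take its limit n instead. *)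
Definition qint (K : fieldType) (q : K) (n : nat) : K :=
  if q == 1 then n%:R else (1 - q ^+ n) / (1 - q).

Definition qfact (K : fieldType) (q : K) (n : nat) : K :=
  \prod_(1 <= i < n.+1) qint q i.

(* Only meaningful for k <= n: beyond that, n - k truncates to 0. *)
Definition qbinom (K : fieldType) (q : K) (n k : nat) : K :=
  qfact q n / (qfact q k * qfact q (n - k)).

(* A formal power series is represented by its sequence of coefficients, so
   that equality of series is pointwise equality =1. *)
Definition fps (K : fieldType) := nat -> K.

Definition fps_mul (K : fieldType) (f g : fps K) : fps K :=
  fun n => \sum_(k < n.+1) f k * g (n - k)%N.

(* The series f(c t) in t. *)
Definition fps_scale (K : fieldType) (c : K) (f : fps K) : fps K :=
  fun n => f n * c ^+ n.

(* The series \sum_n c_n t^n / [n]_q!. *)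
Definition qegf (K : fieldType) (q : K) (c : nat -> K) : fps K :=
  fun n => c n / qfact q n.

(* The deformed q-exponential e_q(z, u), as a series in z; e_q(z) is the case
   u = 1. *)
Definition qexp (K : fieldType) (q u : K) : fps K :=
  qegf q (fun n => u ^+ 'C(n, 2)).

(* Main.v *)
Require Import Defs.
From mathcomp Require Import all_boot all_order all_algebra.
From mathcomp Require Import complex reals.
From mathcomp Require Import zify.
Local Open Scope ring_scope.

Set Implicit Arguments.
Unset Strict Implicit.

Import GRing.Theory.

(* Writing B for the series with coefficients u^C(n,2) A_n / [n]_q!, the
   identity C(n,2) = C(k,2) + C(n-k,2) + k(n-k) turns the recursion for A_n
   into e_q(t,u) = e_q(at,u) B(t).  Replacing t by ty factors the generating
   function of P_n(x,y) as the one of P_n(x,ay) times B(ty), and the theorem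
   compares coefficients. *)

Section FormalPowerSeries.
Variable K : fieldType.
Implicit Types (f g h : fps K) (q u : K).

Lemma eq_fps_mul f f' g g' :
  f =1 f' -> g =1 g' -> fps_mul f g =1 fps_mul f' g'.
Proof. by move=> ff' gg' n; apply: eq_bigr => k _; rewrite ff' gg'. Qed.

Lemma fps_mulC f g : fps_mul f g =1 fps_mul g f.
Proof.
move=> n; rewrite /fps_mul (reindex_inj rev_ord_inj) /=.
by apply: eq_bigr => k _; rewrite subSS subKn 1?mulrC // -ltnS.
Qed.

(* Up to order N, the product of series is that of their truncations, whose
   associativity is the one of polynomials. *)
Lemma fps_mul_poly f g N n : (n <= N)%N ->
  fps_mul f g n = ((\poly_(i < N.+1) f i) * (\poly_(i < N.+1) g i))`_n.
Proof.
move=> le_nN; rewrite coefM; apply: eq_bigr => k _; rewrite !coef_poly !ltnS.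
by rewrite (leq_trans (leq_subr _ _) le_nN) (leq_trans _ le_nN) // -ltnS.
Qed.

Lemma fps_mulA f g h : fps_mul f (fps_mul g h) =1 fps_mul (fps_mul f g) h.
Proof.
(* All truncations share the order [n], although the inner products are only read at orders [n - k]
   and [k]; hence the bound [N] in [fps_mul_poly]. *)
move=> n; pose T e := \poly_(i < n.+1) (e : fps K) i.
transitivity (T f * (T g * T h))`_n.
  rewrite coefM; apply: eq_bigr => k _.
  by rewrite -fps_mul_poly ?leq_subr // coef_poly ltn_ord.
rewrite mulrA coefM; apply: eq_bigr => k _.
have le_kn : (k <= n)%N by rewrite -ltnS.
by rewrite -(fps_mul_poly _ _ le_kn) coef_poly ltnS leq_subr.
Qed.

Lemma fps_scaleM c f g :
  fps_scale c (fps_mul f g) =1 fps_mul (fps_scale c f) (fps_scale c g).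
Proof.
move=> n; rewrite /fps_scale /fps_mul mulr_suml; apply: eq_bigr => k _.
have le_kn : (k <= n)%N by rewrite -ltnS.
have -> : c ^+ n = c ^+ k * c ^+ (n - k) by rewrite -exprD subnKC.
by rewrite mulrACA.
Qed.

Lemma fps_scale_comp c d f :
  fps_scale c (fps_scale d f) =1 fps_scale (d * c) f.
Proof. by move=> n; rewrite /fps_scale exprMn mulrA. Qed.

Lemma fps_scale_qegf q c (s : nat -> K) :
  fps_scale c (qegf q s) =1 qegf q (fun n => s n * c ^+ n).
Proof. by move=> n; rewrite /fps_scale /qegf mulrAC. Qed.

Lemma qfact_neq0 q n :
  (forall m, (1 <= m)%N -> qint q m != 0) -> qfact q n != 0.
Proof.
move=> hq; rewrite /qfact big_nat prodf_seq_neq0; apply/allP => i _.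
by apply/implyP => /andP[i_gt0 _]; apply: hq.
Qed.

(** The numerator of [qbinom q n k] cancels the outer division by [qfact q n]; what remains on both
    sides is the inverse of [qfact q k * qfact q (n - k)]. *)
Lemma fps_mul_qegf q (c d : nat -> K) n : qfact q n != 0 ->
  fps_mul (qegf q c) (qegf q d) n =
  qegf q (fun m => \sum_(0 <= k < m.+1) qbinom q m k * c k * d (m - k)%N) n.
Proof.
move=> qn0; rewrite /fps_mul /qegf big_mkord mulr_suml; apply: eq_bigr => k _.
rewrite /qbinom mulrACA -invfM -[in RHS](mulrA _ (c k)) [RHS]mulrAC.
by rewrite [in RHS](mulrAC (qfact q n)) divff // mul1r mulrC.
Qed.

Lemma bin2D m n : 'C(m + n, 2) = ('C(m, 2) + 'C(n, 2) + m * n)%N.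
Proof.
elim: n => [|n IHn]; first by rewrite addn0 muln0 bin0n !addn0.
by rewrite addnS !binS !bin1 IHn mulnS; lia.
Qed.

(** The integer exponent is minus the cross term [k * (n - k)] of [bin2D], so the two powers cancel
    as [u] is invertible. *)
Lemma exprz_bin2 (u : K) n k : u != 0 -> (k <= n)%N ->
  u ^+ 'C(n, 2) * u ^ (k%:Z * (k%:Z - n%:Z)) =
  u ^+ 'C(k, 2) * u ^+ 'C(n - k, 2).
Proof.
move=> u0 le_kn.
have -> : (k%:Z * (k%:Z - n%:Z) = - (k * (n - k))%N%:Z).
  by rewrite PoszM -subzn // -mulrN opprB.
have -> : 'C(n, 2) = ('C(k, 2) + 'C(n - k, 2) + k * (n - k))%N.
  by rewrite -bin2D subnKC.
by rewrite -exprnN !exprD mulfK ?expf_neq0.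
Qed.

Lemma qexp_factor q u a (A : nat -> K) :
    (forall n, (1 <= n)%N -> qint q n != 0) -> u != 0 ->
    (forall n, \sum_(0 <= k < n.+1)
        qbinom q n k * u ^ (k%:Z * (k%:Z - n%:Z)) * a ^+ k * A (n - k)%N = 1) ->
  qexp q u =1 fps_mul (fps_scale a (qexp q u))
                      (qegf q (fun n => u ^+ 'C(n, 2) * A n)).
Proof.
move=> hq u0 hA n.
rewrite (eq_fps_mul (fps_scale_qegf _ _ _) (frefl _)).
(* The numerator of the left side is written as itself times 1, and this 1 is then expanded by the
   recursion [hA]. *)
rewrite fps_mul_qegf ?qfact_neq0 // /qexp /qegf -[in LHS](mulr1 (u ^+ _)).
rewrite -(hA n) mulr_sumr; congr (_ / _); apply: eq_big_nat => k /andP[_ lt_kn].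
move: (qbinom q n k) => c.
transitivity (c * (u ^+ 'C(n, 2) * u ^ (k%:Z * (k%:Z - n%:Z)))
                  * a ^+ k * A (n - k)%N).
  by rewrite -!mulrA mulrCA.
by rewrite exprz_bin2 // -!mulrA; congr (_ * (_ * _)); rewrite mulrCA.
Qed.

End FormalPowerSeries.

Theorem theorem8 (R : realType) (q u alpha a : R[i])
  (hq : forall n : nat, (1 <= n)%N -> qint q n != 0)
  (hu : u != 0)
  (* aseq alpha n is a_n^(alpha) *)
  (aseq : R[i] -> nat -> R[i])
  (haseq : aseq alpha 0%N != 0)
  (* P alpha n x y u is P_{n,q}^(alpha)(x,y;u) *)
  (P : R[i] -> nat -> R[i] -> R[i] -> R[i] -> R[i])
  (hP : forall x y : R[i],
     fps_mul
       (fps_mul (qegf q (aseq alpha)) (fps_scale x (qexp q 1)))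
       (fps_scale y (qexp q u))
     =1 qegf q (fun n => P alpha n x y u))
  (* A n a u is A_{n,q}(a;u) *)
  (A : nat -> R[i] -> R[i] -> R[i])
  (hA : forall n : nat,
     \sum_(0 <= k < n.+1)
        qbinom q n k * u ^ (k%:Z * (k%:Z - n%:Z)) * a ^+ k * A (n - k)%N a u
     = 1) :
  forall (x y : R[i]) (n : nat),
    P alpha n x y u =
    \sum_(0 <= k < n.+1)
       qbinom q n k * u ^+ 'C(k, 2) * A k a u * y ^+ k
         * P alpha (n - k)%N x (a * y) u.
Proof.
move=> x y n; pose b m := u ^+ 'C(m, 2) * A m a u.
pose B := fps_scale y (qegf q b).
have expE : fps_scale y (qexp q u)
    =1 fps_mul (fps_scale (a * y) (qexp q u)) B.
  (* Scaling is multiplicative, so this is [qexp_factor] with [t] replaced by [t * y]. *)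
  move=> m; rewrite -(eq_fps_mul (fps_scale_comp _ _ _) (frefl _)) -fps_scaleM.
  by rewrite /fps_scale (qexp_factor (A := fun m => A m a u) hq hu hA).
have qn0 : qfact q n != 0 by apply: qfact_neq0.
have: qegf q (fun m => P alpha m x y u) n
    = fps_mul B (qegf q (fun m => P alpha m x (a * y) u)) n.
  (* With [B] split off, the remaining factors are the left side of [hP] at [x] and [a * y]. [B] is
     moved to the front so that [k] indexes its coefficients. *)
  rewrite -hP (eq_fps_mul (frefl _) expE) fps_mulA fps_mulC.
  exact: (eq_fps_mul (frefl _) (hP _ _)).
rewrite (eq_fps_mul (fps_scale_qegf _ _ _) (frefl _)) fps_mul_qegf //.
move/(mulIf (invr_neq0 qn0)) => ->; apply: eq_bigr => k _.
by rewrite /b !mulrA.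
Qed.
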